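(* Let $\mathcal R=(\mathbb R,<,+,\dots)$ be an expansion of the ordered additive group of real numbers which is type B. Then $\mathcal R$ does not define a weak pole.
   Context: ''Definable'' means definable in $\mathcal R$ with parameters. A set is $\omega$-orderable if it is definable and either finite or admits a definable ordering of order type $\omega$; it is dense if dense in some nonempty open interval. $\mathcal R$ is type B if it defines a dense $\omega$-orderable set but does not define some compact subset of some $\mathbb R^k$. A weak pole is a definable family $\{h_d:d\in E\}$ of continuous maps $h_d:[0,d]\to\mathbb R$ such that (i) $E\subseteq\mathbb R_{>0}$ is closed in $\mathbb R_{>0}$ and $(0,\epsilon)\cap E\neq\emptyset$ for all $\epsilon>0$, and (ii) there is $\delta>0$ with $[0,\delta]\subseteq h_d([0,d])$ for all $d\in E$. *)

(* Defs.v *)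
From HB Require Import structures.
From mathcomp Require Import all_boot all_order all_algebra.
From mathcomp Require Import all_classical all_reals all_analysis.

Set Implicit Arguments.
Unset Strict Implicit.
Unset Printing Implicit Defensive.

Import Order.TTheory GRing.Theory Num.Theory.
Import numFieldNormedType.Exports.

Local Open Scope classical_set_scope.
Local Open Scope ring_scope.

(** The symbols that an expansion (R, <, +, ...) adds to the language {<, +};
    the symbols < and + themselves are built into the syntax below. *)
Record language := Language {
  fun_sym : Type;
  fun_arity : fun_sym -> nat;
  rel_sym : Type;
  rel_arity : rel_sym -> nat }.

Record expansion (R : realType) (L : language) := Expansion {
  fun_interp : forall f : fun_sym L, 'rV[R]_(fun_arity f) -> R;
  rel_interp : forall r : rel_sym L, set 'rV[R]_(rel_arity r) }.

Inductive fo_term (L : language) : Type :=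
| TVar of nat
| TAdd of fo_term L & fo_term L
| TFun (f : fun_sym L) of ('I_(fun_arity f) -> fo_term L).

(** Variables are de Bruijn indices; [FEx] binds the index 0. *)
Inductive fo_formula (L : language) : Type :=
| FEq of fo_term L & fo_term L
| FLt of fo_term L & fo_term L
| FRel (r : rel_sym L) of ('I_(rel_arity r) -> fo_term L)
| FNot of fo_formula L
| FAnd of fo_formula L & fo_formula L
| FEx of fo_formula L.

Section Definability.
Variables (R : realType) (L : language) (M : expansion R L).

Fixpoint term_eval (v : nat -> R) (t : fo_term L) : R :=
  match t with
  | TVar i => v i
  | TAdd t1 t2 => term_eval v t1 + term_eval v t2
  | TFun f ts => fun_interp M (\row_i term_eval v (ts i))
  end.

Definition push (a : R) (v : nat -> R) (i : nat) : R :=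
  if i is j.+1 then v j else a.

Fixpoint sat (v : nat -> R) (phi : fo_formula L) : Prop :=
  match phi with
  | FEq t1 t2 => term_eval v t1 = term_eval v t2
  | FLt t1 t2 => term_eval v t1 < term_eval v t2
  | FRel r ts => rel_interp M (\row_i term_eval v (ts i))
  | FNot psi => ~ sat v psi
  | FAnd psi1 psi2 => sat v psi1 /\ sat v psi2
  | FEx psi => exists a : R, sat (push a v) psi
  end.

(** The variables i < n range over the coordinates of x; those with n <= i are
    assigned the parameters p i (only finitely many occur in a formula). *)
Definition assign n (x : 'rV[R]_n) (p : nat -> R) (i : nat) : R :=
  if insub i is Some j then x 0 j else p i.

Definition definable n (A : set 'rV[R]_n) : Prop :=
  exists (phi : fo_formula L) (p : nat -> R),
    A = [set x | sat (assign x p) phi].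

Definition set_row1 (A : set R) : set 'rV[R]_1 := [set x | A (x 0 0)].

Definition has_order_type_omega T (D : set T) (prec : T -> T -> Prop) : Prop :=
  exists2 f : nat -> T,
    set_bij [set: nat] D f & forall i j, (i < j)%N <-> prec (f i) (f j).

(** [prec] is used only through its restriction to D, a subset of R^(n + n). *)
Definition definable_order n (D : set 'rV[R]_n)
    (prec : 'rV[R]_n -> 'rV[R]_n -> Prop) : Prop :=
  definable [set z : 'rV[R]_(n + n) |
    [/\ D (lsubmx z), D (rsubmx z) & prec (lsubmx z) (rsubmx z)]].

Definition omega_orderable n (D : set 'rV[R]_n) : Prop :=
  definable D /\
  (finite_set D \/
   exists2 prec : 'rV[R]_n -> 'rV[R]_n -> Prop,
     definable_order D prec & has_order_type_omega D prec).

Definition dense_in_some_interval (D : set R) : Prop :=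
  exists I : set R,
    [/\ is_interval I, open I, I !=set0 & I `<=` closure (D `&` I)].

Definition type_B : Prop :=
  (exists2 D : set R, omega_orderable (set_row1 D) & dense_in_some_interval D) /\
  (exists k (K : set 'rV[R]_k), compact K /\ ~ definable K).

(** h d is only meaningful on [0, d] for d in E; its values elsewhere are
    irrelevant. *)
Definition definable_family (E : set R) (h : R -> R -> R) : Prop :=
  definable (set_row1 E) /\
  definable [set z : 'rV[R]_3 |
    [/\ E (z 0 0), 0 <= z 0 1 <= z 0 0 & z 0 2 = h (z 0 0) (z 0 1)]].

Definition weak_pole (E : set R) (h : R -> R -> R) : Prop :=
  [/\ definable_family E h,
      forall d, E d -> {within `[0, d], continuous (h d)},
      (exists2 C : set R, closed C & E = C `&` [set d | 0 < d]),
      forall e : R, 0 < e -> `]0, e[ `&` E !=set0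
    & exists2 delta : R, 0 < delta &
        forall d, E d -> `[0, delta] `<=` h d @` `[0, d]].

Definition defines_weak_pole : Prop :=
  exists (E : set R) (h : R -> R -> R), weak_pole E h.

End Definability.

(* Main.v *)
Require Import Defs.
From HB Require Import structures.
From mathcomp Require Import all_boot all_order all_algebra.
From mathcomp Require Import all_classical all_reals all_analysis.
From mathcomp Require Import lra.

Set Implicit Arguments.
Unset Strict Implicit.
Unset Printing Implicit Defensive.

Import Order.TTheory GRing.Theory Num.Theory.
Import numFieldNormedType.Exports.

Local Open Scope classical_set_scope.
Local Open Scope ring_scope.

(** In the presence of a dense set D = {d_0, d_1, ...} of order type omega and a
    weak pole, every compact set turns out to be definable, contradicting type B.
    Given an index i and a real c lying in a gap ]l, u[ of {d_0, ..., d_i}, put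
    F(c, i) = h_r (c - l), where r is the largest element of E with r <= u - l:
    as c runs through the gap, F(c, i) takes every value in [0, delta].
    Moreover a real c determines its left records, the d_i < c such that no
    earlier d_e lies in ]d_i, c[, and c can be chosen so that the indices t_n of
    its left records grow as fast as desired.  Nested intervals then produce,
    for any sequence (y_n) in [0, delta]^k, codes c, c_1, ..., c_k such that
    |F(c_j, t_n) - (y_n)_j| is as small as desired for all n.  A compact set is,
    up to translation and scaling by an integer, the set of limit points of such
    a sequence, and this set of limit points is definable from the codes. *)

(** * Renaming variables in terms and formulas *)

Section Renaming.
Variable L : language.

Fixpoint rename_term (f : nat -> nat) (t : fo_term L) : fo_term L :=
  match t with
  | TVar i => TVar L (f i)
  | TAdd t1 t2 => TAdd (rename_term f t1) (rename_term f t2)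
  | TFun g ts => TFun (fun i => rename_term f (ts i))
  end.

Definition lift_rename (f : nat -> nat) (i : nat) : nat :=
  if i is j.+1 then (f j).+1 else 0%N.

Fixpoint rename (f : nat -> nat) (phi : fo_formula L) : fo_formula L :=
  match phi with
  | FEq t1 t2 => FEq (rename_term f t1) (rename_term f t2)
  | FLt t1 t2 => FLt (rename_term f t1) (rename_term f t2)
  | FRel r ts => FRel (fun i => rename_term f (ts i))
  | FNot psi => FNot (rename f psi)
  | FAnd psi1 psi2 => FAnd (rename f psi1) (rename f psi2)
  | FEx psi => FEx (rename (lift_rename f) psi)
  end.

Variables (R : realType) (M : expansion R L).

Lemma term_eval_rename f v t :
  term_eval M v (rename_term f t) = term_eval M (v \o f) t.
Proof.
elim: t => [i|t1 IH1 t2 IH2|g ts IH] //=; first by rewrite IH1 IH2.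
by congr (fun_interp _ _); apply/rowP => i; rewrite !mxE IH.
Qed.

Lemma sat_rename f v phi : sat M v (rename f phi) <-> sat M (v \o f) phi.
Proof.
elim: phi f v => [t1 t2|t1 t2|r ts|psi IH|psi1 IH1 psi2 IH2|psi IH] f v /=;
  rewrite ?term_eval_rename ?IH ?IH1 ?IH2 //.
- suff -> : (\row_i term_eval M v (rename_term f (ts i))) =
            (\row_i term_eval M (v \o f) (ts i)) by [].
  by apply/rowP => i; rewrite !mxE term_eval_rename.
- have push_lift a : push a v \o lift_rename f = push a (v \o f).
    by apply/funext => -[|i].
  by split=> -[a] Ha; exists a; move: Ha; rewrite IH push_lift.
Qed.

End Renaming.

(** * Closure properties of predicates on assignments that are definable with parameters *)

Section DefinablePredicates.
Variables (R : realType) (L : language) (M : expansion R L).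

(* Variables sit at the even indices and parameters at the odd ones, so that
   there is always room for more of either. *)
Definition interleave (v p : nat -> R) (i : nat) : R :=
  if odd i then p i./2 else v i./2.

Definition definable_pred (P : (nat -> R) -> Prop) : Prop :=
  exists (phi : fo_formula L) (p : nat -> R),
    forall v, P v <-> sat M (interleave v p) phi.

Definition definable_term (X : (nat -> R) -> R) : Prop :=
  exists (t : fo_term L) (p : nat -> R),
    forall v, X v = term_eval M (interleave v p) t.

Lemma interleave_double v p i : interleave v p i.*2 = v i.
Proof. by rewrite /interleave odd_double doubleK. Qed.

Lemma interleave_doubleS v p i : interleave v p i.*2.+1 = p i.
Proof. by rewrite /interleave /= odd_double /= uphalf_double. Qed.

(** To combine two formulas, their parameter sequences are merged into [interleave p1 p2]. These
    renamings fix the even (variable) indices and send each parameter index to its new place in the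
    merged sequence. *)
Definition to_left (i : nat) : nat := if odd i then (i./2).*2.*2.+1 else i.
Definition to_right (i : nat) : nat := if odd i then (i./2).*2.+1.*2.+1 else i.

Lemma interleave_to_left v p1 p2 :
  interleave v (interleave p1 p2) \o to_left = interleave v p1.
Proof.
apply/funext => i; rewrite /= /to_left [RHS]/interleave.
case: ifP => oi; first by rewrite interleave_doubleS interleave_double.
by rewrite /interleave oi.
Qed.

Lemma interleave_to_right v p1 p2 :
  interleave v (interleave p1 p2) \o to_right = interleave v p2.
Proof.
apply/funext => i; rewrite /= /to_right [RHS]/interleave.
case: ifP => oi; first by rewrite !interleave_doubleS.
by rewrite /interleave oi.
Qed.

Lemma definable_term_var i : definable_term (fun v => v i).
Proof.
by exists (TVar L i.*2), (fun=> 0) => v /=; rewrite interleave_double.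
Qed.

Lemma definable_term_cst c : definable_term (fun=> c).
Proof. by exists (TVar L 1), (fun=> c). Qed.

Lemma definable_termD X Y : definable_term X -> definable_term Y ->
  definable_term (fun v => X v + Y v).
Proof.
move=> [t1 [p1 Xt]] [t2 [p2 Yt]].
exists (TAdd (rename_term to_left t1) (rename_term to_right t2)).
exists (interleave p1 p2) => v /=.
by rewrite !term_eval_rename interleave_to_left interleave_to_right Xt Yt.
Qed.

Lemma definable_termMn X n : definable_term X ->
  definable_term (fun v => X v *+ n).
Proof.
move=> Xt; elim: n => [|n IH].
  by under eq_fun do rewrite mulr0n; exact: definable_term_cst.
by under eq_fun do rewrite mulrS; exact: definable_termD.
Qed.

Lemma definable_pred_eq X Y : definable_term X -> definable_term Y ->
  definable_pred (fun v => X v = Y v).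
Proof.
move=> [t1 [p1 Xt]] [t2 [p2 Yt]].
exists (FEq (rename_term to_left t1) (rename_term to_right t2)).
exists (interleave p1 p2) => v /=.
by rewrite !term_eval_rename interleave_to_left interleave_to_right Xt Yt.
Qed.

Lemma definable_pred_lt X Y : definable_term X -> definable_term Y ->
  definable_pred (fun v => X v < Y v).
Proof.
move=> [t1 [p1 Xt]] [t2 [p2 Yt]].
exists (FLt (rename_term to_left t1) (rename_term to_right t2)).
exists (interleave p1 p2) => v /=.
by rewrite !term_eval_rename interleave_to_left interleave_to_right Xt Yt.
Qed.

Lemma definable_predN P : definable_pred P -> definable_pred (fun v => ~ P v).
Proof. by move=> [phi [p Pp]]; exists (FNot phi), p => v /=; rewrite Pp. Qed.

Lemma definable_predI P Q : definable_pred P -> definable_pred Q ->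
  definable_pred (fun v => P v /\ Q v).
Proof.
move=> [phi [p Pp]] [psi [q Qq]].
exists (FAnd (rename to_left phi) (rename to_right psi)), (interleave p q) => v.
by rewrite /= !sat_rename interleave_to_left interleave_to_right Pp Qq.
Qed.

Lemma definable_pred_ex (P : R -> (nat -> R) -> Prop) :
  definable_pred (fun v => P (v 0%N) (fun i => v i.+1)) ->
  definable_pred (fun v => exists a, P a v).
Proof.
move=> [phi [p Pp]].
(* [FEx] shifts every index by one and so exchanges the parities; [f] undoes this, with the bound
   value at index 0 becoming variable 0. *)
pose f i := if odd i then i.+1 else if i is j.+2 then j.+1 else 0%N.
exists (FEx (rename f phi)), p => v /=.
have pushE a : push a (interleave v p) \o f = interleave (push a v) p.
  apply/funext => i; rewrite /= /f [RHS]/interleave.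
  case: ifP => oi; first by rewrite /= /interleave oi.
  by case: i oi => [|[|i]] //= /negbFE oi; rewrite /interleave (negbTE oi).
split=> -[a Ha]; exists a; move: Ha; rewrite sat_rename pushE -Pp //.
Qed.

Lemma eq_definable_pred P Q : (forall v, P v <-> Q v) ->
  definable_pred P -> definable_pred Q.
Proof. by move=> PQ [phi [p Pp]]; exists phi, p => v; rewrite -PQ. Qed.

Lemma definable_pred_le X Y : definable_term X -> definable_term Y ->
  definable_pred (fun v => X v <= Y v).
Proof.
move=> Xt Yt; apply: eq_definable_pred (definable_predN (definable_pred_lt Yt Xt)).
by move=> v; rewrite leNgt; split => /negP.
Qed.

Lemma definable_pred_imp P Q : definable_pred P -> definable_pred Q ->
  definable_pred (fun v => P v -> Q v).
Proof.
move=> Pd Qd.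
apply: eq_definable_pred (definable_predN (definable_predI Pd (definable_predN Qd))).
by move=> v; split=> [nPQ Pv|PQ [/PQ]//]; apply: contrapT => nQ; exact: nPQ.
Qed.

Lemma definable_pred_all (P : R -> (nat -> R) -> Prop) :
  definable_pred (fun v => P (v 0%N) (fun i => v i.+1)) ->
  definable_pred (fun v => forall a, P a v).
Proof.
move=> Pd; have := definable_predN
  (@definable_pred_ex (fun a v => ~ P a v) (definable_predN Pd)).
apply: eq_definable_pred => v; split=> [nP a|Pv [a]]; last by apply; exact: Pv.
by apply: contrapT => nPa; apply: nP; exists a.
Qed.

Lemma definable_pred_fin (k : nat) (P : 'I_k -> (nat -> R) -> Prop) :
  (forall j, definable_pred (P j)) ->
  definable_pred (fun v => forall j, P j v).
Proof.
move=> Pd; suff : definable_pred (fun v => forall j, j \in enum 'I_k -> P j v).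
  apply: eq_definable_pred => v; split=> Pv j //.
  by apply: Pv; rewrite mem_enum.
elim: (enum 'I_k) => [|i s IH].
  apply: (@eq_definable_pred (fun=> 0 = 0 :> R)) => //.
  exact: (definable_pred_eq (definable_term_cst 0) (definable_term_cst 0)).
apply: eq_definable_pred (definable_predI (Pd i) IH) => v.
split=> [[Pi Ps] j|Pv]; first by rewrite inE => /orP[/eqP ->//|]; exact: Ps.
by split=> [|j js]; apply: Pv; rewrite inE ?eqxx// js orbT.
Qed.

Lemma definable_pred_mem n (A : set 'rV[R]_n) (f : 'I_n -> nat) :
  definable M A -> definable_pred (fun v => A (\row_i v (f i))).
Proof.
move=> [phi [p ->]].
pose g i := if insub i is Some j then (f j).*2 else i.*2.+1.
exists (rename g phi), p => v; rewrite /= sat_rename.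
suff -> : interleave v p \o g = assign (\row_i v (f i)) p by [].
apply/funext => i; rewrite /= /g /assign.
by case: insubP => [j _ _|_]; rewrite ?interleave_double ?interleave_doubleS ?mxE.
Qed.

Lemma definable_of_pred n (A : set 'rV[R]_n) :
  definable_pred (fun v => A (\row_i v i)) -> definable M A.
Proof.
move=> [phi [p Ap]].
(* Parameters move behind the [n] coordinates. Variables from [n] on are all sent to index [n], that
   is to the value [p 0]: the predicate looks only at the first [n] variables, so any value will
   do. *)
pose g i := if odd i then (n + i./2)%N else if (i./2 < n)%N then i./2 else n.
exists (rename g phi), (fun i => p (i - n)%N); apply/seteqP.
pose w (x : 'rV[R]_n) i := if insub i is Some j then x 0 j else p 0%N.
have wE (x : 'rV[R]_n) : \row_i w x i = x.
  by apply/rowP => i; rewrite mxE /w valK.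
have gE (x : 'rV[R]_n) :
    assign x (fun i => p (i - n)%N) \o g = interleave (w x) p.
  apply/funext => i; rewrite /= /g /interleave /assign /w; case: ifP => oi.
    by rewrite insubF ?addKn// ltnNge leq_addr.
  case: ifP => ni; first by case: insubP => //; rewrite ni.
  by rewrite insubF ?ltnn// subnn insubF.
suff AE x : A x <-> sat M (assign x (fun i => p (i - n)%N)) (rename g phi).
  by split=> x /AE.
by rewrite sat_rename gE -Ap wE.
Qed.

End DefinablePredicates.

(** * Nested and shrinking real intervals *)

Section RealLemmas.
Variable R : realType.
Implicit Types p q : R.

Lemma nested_intervals (p q : nat -> R) :
  (forall n, p n < p n.+1) -> (forall n, q n.+1 < q n) ->
  (forall n, p n < q n) -> exists c, forall n, p n < c /\ c < q n.
Proof.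
move=> pS qS pq.
have lep m n : (m <= n)%N -> p m <= p n.
  by apply: (homo_leq le_refl le_trans) => i; exact: ltW.
have leq m n : (m <= n)%N -> q n <= q m.
  apply: (homo_leq (r := fun x y => y <= x)) => [//|x y z xy yz|i].
    exact: le_trans yz xy.
  exact: ltW.
have pqmn m n : p m <= q n.
  apply: le_trans (lep _ _ (leq_maxl m n)) _.
  exact: le_trans (ltW (pq _)) (leq _ _ (leq_maxr m n)).
have ub n : ubound (range p) (q n) by move=> _ [m _ <-].
exists (sup (range p)) => n; split.
  apply: lt_le_trans (pS n) _; apply: ub_le_sup; first by exists (q 0%N).
  by exists n.+1.
apply: le_lt_trans (qS n); apply: ge_sup; last exact: ub.
by exists (p 0%N), 0%N.
Qed.

Lemma shrink_avoiding (s : seq R) p q : p < q ->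
  exists q', [/\ p < q', q' < q & forall x, x \in s -> ~ (p < x /\ x < q')].
Proof.
move=> pq; elim: s => [|x s [q' [pq' q'q Hq']]].
  by exists ((p + q) / 2); split=> //; lra.
have [px|xp] := ltP p x.
  exists (Num.min x q'); split=> [||y].
  - by rewrite lt_min px.
  - by rewrite gt_min q'q orbT.
  - rewrite inE => /orP[/eqP ->|ys]; rewrite lt_min => -[py /andP[yx yq]].
      by rewrite ltxx in yx.
    exact: (Hq' y).
exists q'; split=> // y; rewrite inE => /orP[/eqP -> []|/Hq' //].
by rewrite ltNge xp.
Qed.

End RealLemmas.

(** * Coding a sequence in [0, delta]^k by reals *)

Section Coding.
Variables (R : realType) (d : nat -> R) (E : set R) (h : R -> R -> R).
Variables (delta a b : R).
Hypothesis d_inj : injective d.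
Hypothesis d_dense :
  forall p q, a <= p -> p < q -> q <= b -> exists i, p < d i /\ d i < q.
Hypothesis E_closed : exists2 C : set R, closed C & E = C `&` [set r | 0 < r].
Hypothesis E_small : forall e : R, 0 < e -> `]0, e[ `&` E !=set0.
Hypothesis h_cont : forall r, E r -> {within `[0, r], continuous (h r)}.
Hypothesis h_onto : forall r, E r -> `[0, delta] `<=` h r @` `[0, r].

(** The graph of F, with l and u the ends of the gap of [S] around [c] and s = c - l. Differences
    are expressed through sums, and the last conjunct has the shape of [definable_family], so that
    the formula can be read off. Taking a set [S] in place of an index allows [S] to be given later
    by a definable set. *)
Definition decodes (S : set R) (c z : R) : Prop :=
  exists l u r s, S l /\ S u /\ l < c /\ c < u /\
    (forall e, S e -> ~ (l < e /\ e < u)) /\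
    r + l <= u /\ (forall r', E r' -> r' + l <= u -> r' <= r) /\
    s + l = c /\ [/\ E r, 0 <= s <= r & z = h r s].

Definition initial (i : nat) : set R := [set d e | e in [set e | (e <= i)%N]].

Definition left_record (c : R) (i : nat) : Prop :=
  d i < c /\ forall e, (e < i)%N -> ~ (d i < d e /\ d e < c).

(** The supremum of the elements of [E] up to [x] is positive because [E] has arbitrarily small
    elements, and is in [E] because [E] is closed in the positive reals. *)
Lemma E_max x : 0 < x ->
  exists r, [/\ E r, r <= x & forall r', E r' -> r' <= x -> r' <= r].
Proof.
move=> x0; have [C Ccl EC] := E_closed.
pose A := [set r | E r /\ r <= x].
have [e [/= e0 Ee]] := E_small x0; move: e0; rewrite in_itv/= => /andP[e0 ex].
have A0 : A !=set0 by exists e; split=> //; exact: ltW.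
have Aub : ubound A x by move=> r [].
have Asup : has_sup A by split=> //; exists x.
have lesup r' : E r' -> r' <= x -> r' <= sup A.
  by move=> Er' r'x; apply: ub_le_sup; [exists x|].
exists (sup A); split => //; last exact: ge_sup.
rewrite EC; split; last first.
  by apply: lt_le_trans e0 _; apply: lesup => //; exact: ltW.
apply: Ccl => B /nbhs_ballP[eta /= eta0 etaB].
have [r [Er rx] Hr] := sup_adherent eta0 Asup.
exists r; split; first by move: Er; rewrite EC => -[].
apply: etaB; rewrite /ball/= ltr_norml; have := lesup r Er rx; lra.
Qed.

Lemma next_index i l e0 : (e0 <= i)%N -> l < d e0 ->
  exists u, [/\ (u <= i)%N, l < d u &
    forall e, (e <= i)%N -> l < d e -> d u <= d e].
Proof.
move=> e0i le0.
have P0 : l < d (inord e0 : 'I_i.+1) by rewrite inordK.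
case: (@Order.TotalTheory.arg_minP _ _ _ (inord e0 : 'I_i.+1)
  (fun e : 'I_i.+1 => l < d e) (fun e : 'I_i.+1 => d e) P0) => u lu umin.
exists u; split=> // [|e ei le]; first by rewrite -ltnS.
by have := umin (inord e); rewrite inordK//; apply.
Qed.

(* On each gap of [initial i] the decoding is a translate of some [h r]
   restricted to [0, r], and hence takes all values in [0, delta]. *)
Lemma decodes_approx i i1 i2 p q y eps :
  (i1 <= i)%N -> (i2 <= i)%N -> p < d i1 -> d i1 < d i2 -> d i2 < q ->
  0 <= y <= delta -> 0 < eps ->
  exists p' q', [/\ p < p', p' < q', q' < q &
    forall c, p' < c -> c < q' ->
      (exists z, decodes (initial i) c z) /\
      (forall z, decodes (initial i) c z -> `|z - y| < eps)].
Proof.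
move=> i1i i2i pd1 d12 d2q y_itv eps0.
have [u0 [u0i lu0 u0min]] := next_index i2i d12.
set l := d i1 in pd1 d12 lu0 u0min; set u := d u0 in lu0 u0min.
have lu : l < u by [].
have uq : u < q by exact: le_lt_trans (u0min _ i2i d12) d2q.
have gap e : initial i e -> ~ (l < e /\ e < u).
  by move=> [e' /= e'i <-] [le' e'u]; have := u0min _ e'i le'; rewrite leNgt e'u.
have Sl : initial i l by exists i1.
have Su : initial i u by exists u0.
have ul0 : 0 < u - l by rewrite subr_gt0.
have [r [Er rul rmax]] := E_max ul0.
have r0 : 0 < r by have [C _ EC] := E_closed; move: Er; rewrite EC => -[].
have [s /= s_itv hsy] := h_onto Er (y_itv : (`[0, delta]%classic y)).
have /subspace_continuousP/(_ _ s_itv)/cvgrPdist_lt/(_ _ eps0) := h_cont Er.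
rewrite near_withinE => /nbhs_ballP[eta /= eta0 Heta].
move: (s_itv); rewrite /= in_itv/= => /andP[s0 sr].
(* A neighbourhood of l + s, truncated to ]l, l + r[ because [h r] is meaningful only on [0, r]; it
   is nonempty even when s is 0 or r. *)
exists (l + Num.max 0 (s - eta)), (l + Num.min r (s + eta)); split.
- by rewrite (lt_le_trans pd1)// lerDl le_max lexx.
- rewrite ltrD2l gt_max !lt_min r0/=; apply/and3P; split; lra.
- apply: le_lt_trans uq; rewrite -lerBrDl ge_min rul //.
move=> c; rewrite -ltrBrDl gt_max => /andP[c0 ce].
rewrite -ltrBlDl lt_min => /andP[cr ce'].
have hc : `|h r (c - l) - y| < eps.
  rewrite -hsy distrC; apply: (Heta (c - l)).
    by rewrite /ball/= ltr_norml; apply/andP; split; lra.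
  by rewrite /= in_itv/=; apply/andP; split; exact: ltW.
split=> [|z]; last first.
  (* The gap around c, the largest r and the offset s are all determined by c, so the decoded value
     is unique. *)
  move=> [l' [u' [r' [s' [Sl' [Su' [l'c [cu' [gap' [r'u' [r'max]]]]]]]]]]].
  move=> [sc [Er' _ ->]].
  have ll' : l' = l.
    apply/eqP; rewrite eq_le !leNgt; apply/andP; split; apply/negP => Hl.
      by apply: (gap l' Sl'); split=> //; lra.
    by apply: (gap' l Sl); split=> //; lra.
  have uu' : u' = u.
    apply/eqP; rewrite eq_le !leNgt; apply/andP; split; apply/negP => Hu.
      by apply: (gap' u Su); split=> //; lra.
    by apply: (gap u' Su'); split=> //; lra.
  have rr' : r' = r.
    apply/eqP; rewrite eq_le; apply/andP; split; first by apply: rmax => //; lra.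
    by apply: r'max => //; lra.
  by have -> : s' = c - l; [lra|rewrite rr'].
exists (h r (c - l)), l, u, r, (c - l).
do !split=> //; try lra.
by move=> r' Er' r'u; apply: rmax => //; lra.
Qed.

Variable k : nat.

(* The code under construction ranges over ]d t, v[ and the [k] value codes
   over the open intervals [J j]. *)
Record stage := Stage { st_t : nat; st_v : R; st_J : 'I_k -> R * R }.

(** Two points of [initial d i] inside each interval are what [decodes_approx] needs in order to
    refine it. *)
Definition resolved (i : nat) (J : 'I_k -> R * R) : Prop :=
  forall j, exists i1 i2, [/\ (i1 <= i)%N, (i2 <= i)%N,
    (J j).1 < d i1, d i1 < d i2 & d i2 < (J j).2].

(** The last clause ensures that whichever index is met next in the interval is new and large enough
    for all value intervals to be refined there. *)
Definition stage_ok (s : stage) : Prop :=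
  [/\ a <= d (st_t s), d (st_t s) < st_v s, st_v s <= b,
      forall j, [/\ a <= (st_J s j).1, (st_J s j).1 < (st_J s j).2
                  & (st_J s j).2 <= b]
    & forall i, d (st_t s) < d i -> d i < st_v s ->
        (st_t s < i)%N /\ resolved i (st_J s)].

(** The third clause, minimality of the new index, is what makes it a left record of the final code
    and excludes other left records in between. *)
Definition stage_step (y : 'I_k -> R) (eps : R) (s s' : stage) : Prop :=
  [/\ (st_t s < st_t s')%N,
      d (st_t s) < d (st_t s') /\ st_v s' < st_v s,
      forall i, d (st_t s) < d i -> d i < st_v s -> (st_t s' <= i)%N,
      forall j, (st_J s j).1 < (st_J s' j).1 /\ (st_J s' j).2 < (st_J s j).2
    & forall j c, (st_J s' j).1 < c -> c < (st_J s' j).2 ->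
        (exists z, decodes (initial (st_t s')) c z) /\
        (forall z, decodes (initial (st_t s')) c z -> `|z - y j| < eps)].

Lemma resolved_large J :
  (forall j, [/\ a <= (J j).1, (J j).1 < (J j).2 & (J j).2 <= b]) ->
  exists m, forall i, (m <= i)%N -> resolved i J.
Proof.
move=> HJ.
have ex j : exists mj, forall i, (mj <= i)%N -> exists i1 i2, [/\ (i1 <= i)%N,
    (i2 <= i)%N, (J j).1 < d i1, d i1 < d i2 & d i2 < (J j).2].
  have [aJ JJ Jb] := HJ j.
  have [i1 [Ji1 i1J]] := d_dense aJ JJ Jb.
  have [i2 [Ji2 i2J]] := d_dense (ltW (le_lt_trans aJ Ji1)) i1J Jb.
  exists (maxn i1 i2) => i; rewrite geq_max => /andP[? ?].
  by exists i1, i2.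
have [m Hm] := choice ex.
exists (\max_j m j)%N => i mi j; apply: Hm.
exact: leq_trans (leq_bigmax j) mi.
Qed.

(** Finitely many [d i] have small index; lowering [v] below those lying to the right of [d t]
    leaves only large indices in the interval. *)
Lemma stage_tail t v J : a <= d t -> d t < v -> v <= b ->
  (forall j, [/\ a <= (J j).1, (J j).1 < (J j).2 & (J j).2 <= b]) ->
  exists v', v' < v /\ stage_ok (Stage t v' J).
Proof.
move=> at_ tv vb HJ; have [m Hm] := resolved_large HJ.
have [v' [tv' v'v Hv']] := shrink_avoiding [seq d i | i <- iota 0 (maxn m t).+1] tv.
exists v'; split=> //; split=> //=; first exact: le_trans (ltW v'v) vb.
move=> i ti iv; have : ~~ (i <= maxn m t)%N.
  apply/negP => im; apply: (Hv' (d i)); last by split.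
  by apply: map_f; rewrite mem_iota.
by rewrite -ltnNge gtn_max => /andP[mi ti']; split=> //; apply: Hm; exact: ltnW.
Qed.

Lemma stage_next y eps s : (forall j, 0 <= y j <= delta) -> 0 < eps ->
  stage_ok s -> exists s', stage_ok s' /\ stage_step y eps s s'.
Proof.
move=> y_itv eps0 [at_ tv vb HJ Hres].
have exi : exists i, (d (st_t s) < d i) && (d i < st_v s).
  by have [i [? ?]] := d_dense at_ tv vb; exists i; apply/andP.
(* The next left record is the least index whose point falls in the current interval. *)
have [t' /andP[tt' t'v] t'min] := ex_minnP exi.
have [tlt res] := Hres _ tt' t'v.
have exJ j : exists J' : R * R, [/\ (st_J s j).1 < J'.1, J'.1 < J'.2,
    J'.2 < (st_J s j).2 & forall c, J'.1 < c -> c < J'.2 ->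
      (exists z, decodes (initial t') c z) /\
      (forall z, decodes (initial t') c z -> `|z - y j| < eps)].
  have [i1 [i2 [? ? ? ? ?]]] := res j.
  have [p' [q' [? ? ? ?]]] : exists p' q', [/\ (st_J s j).1 < p', p' < q',
      q' < (st_J s j).2 & forall c, p' < c -> c < q' ->
      (exists z, decodes (initial t') c z) /\
      (forall z, decodes (initial t') c z -> `|z - y j| < eps)].
    by apply: (@decodes_approx t' i1 i2).
  by exists (p', q').
have [J' HJ'] := choice exJ.
have [||v' [v'v ok']] := @stage_tail t' (st_v s) J' _ t'v vb.
- by apply: le_trans at_ _; exact: ltW.
- move=> j; have [? ? ? _] := HJ' j; have [? ? ?] := HJ j.
  by split=> //; lra.
exists (Stage t' v' J'); split=> //; split=> //=.
- by move=> i ti iv; apply: t'min; rewrite ti iv.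
- by move=> j; have [? ? ? _] := HJ' j.
- by move=> j; have [] := HJ' j.
Qed.

Lemma coding (y : nat -> 'I_k -> R) (eps : nat -> R) : a < b ->
  (forall n j, 0 <= y n j <= delta) -> (forall n, 0 < eps n) ->
  exists (c : R) (cs : 'I_k -> R) (t : nat -> nat),
    [/\ forall n, (t n < t n.+1)%N,
        forall n, left_record c (t n),
        forall i, (t 0 <= i)%N -> left_record c i -> exists n, i = t n
      & forall n j, (exists z, decodes (initial (t n)) (cs j) z) /\
          (forall z, decodes (initial (t n)) (cs j) z -> `|z - y n j| < eps n)].
Proof.
move=> ab y_itv eps0.
(* The implication makes the successor relation total, as [choice] requires. *)
have exs (ns : nat * stage) : exists s', stage_ok ns.2 ->
    stage_ok s' /\ stage_step (y ns.1) (eps ns.1) ns.2 s'.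
  have [ok|nok] := pselect (stage_ok ns.2); last by exists ns.2.
  by have [s' Hs'] := stage_next (y_itv ns.1) (eps0 ns.1) ok; exists s'.
have [nxt Hnxt] := choice exs.
have [t0 [at0 t0b]] := d_dense (lexx a) ab (lexx b).
have [|v0 [_ ok0]] := @stage_tail t0 b (fun=> (a, b)) (ltW at0) t0b (lexx b).
  by move=> j /=; split.
pose s := fix s n := if n is m.+1 then nxt (m, s m) else Stage t0 v0 (fun=> (a, b)).
have ok n : stage_ok (s n).
  by elim: n => [//|n IH]; have [] := Hnxt (n, s n) IH.
have step n : stage_step (y n) (eps n) (s n) (s n.+1).
  by have [] := Hnxt (n, s n) (ok n).
have [c Hc] : exists c, forall n, d (st_t (s n)) < c /\ c < st_v (s n).
  apply: nested_intervals => n; have [_ [] //] := step n.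
  by have [] := ok n.
have exc j : exists cj, forall n, (st_J (s n) j).1 < cj /\ cj < (st_J (s n) j).2.
  apply: nested_intervals => n; have [_ _ _ /(_ j)[] //] := step n.
  by have [_ _ _ /(_ j)[]] := ok n.
have [cs Hcs] := choice exc.
(* The shift by one discards the initial stage, where no value is coded yet. *)
exists c, cs, (fun n => st_t (s n.+1)); split=> [n|n|i|n j].
- by have [] := step n.+1.
- split=> [|e et [te ec]]; first by have [] := Hc n.+1.
  have [_ [tt _] tmin _ _] := step n.
  have := tmin e (lt_trans tt te) (lt_trans ec (Hc n).2).
  by rewrite leqNgt et.
(* Let i lie between two consecutive coded indices. If its point is left of the earlier coded point,
   then i is not a left record; if it is to the right, minimality of the later index is violated. *)
- move=> ti [ic Hi].
  have exn : exists n, (i < st_t (s n.+1))%N.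
    exists i; elim: (i) => [|m IH]; last first.
      by have [tlt _ _ _ _] := step m.+1; exact: leq_ltn_trans IH tlt.
    by have [tlt _ _ _ _] := step 0%N; exact: leq_ltn_trans (leq0n _) tlt.
  have [[|n] iltn nmin] := ex_minnP exn; first by rewrite ltnNge ti in iltn.
  have tni : (st_t (s n.+1) <= i)%N.
    by rewrite leqNgt; apply/negP => /nmin; rewrite ltnn.
  exists n; have [//|tnei] := eqVneq i (st_t (s n.+1)).
  have tlt : (st_t (s n.+1) < i)%N by rewrite ltn_neqAle eq_sym tnei.
  have [dlt|dgt|/d_inj//] := ltgtP (d i) (d (st_t (s n.+1))).
    by case: (Hi _ tlt); split=> //; have [] := Hc n.+1.
  have [_ _ tmin _ _] := step n.+1.
  have := tmin i dgt (lt_trans ic (Hc n.+1).2).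
  by rewrite leqNgt iltn.
- have [_ _ _ _] := step n; apply.
  + by have [] := Hcs j n.+1.
  + by have [] := Hcs j n.+1.
Qed.

End Coding.

(** * Compact sets of row vectors and dense sequences in them *)

Section CompactRowSets.
Variables (R : realType) (k : nat).
Implicit Types (K : set 'rV[R]_k) (x y : 'rV[R]_k).

Lemma compact_row_closed K x : compact K ->
  (forall e : R, 0 < e -> exists2 y, K y & forall j, `|y 0 j - x 0 j| < e) ->
  K x.
Proof.
move=> cK Hx; have clK := compact_closed (@norm_hausdorff R _) cK.
apply: clK => B /nbhs_ballP[e /= e0 eB].
have [y Ky xy] := Hx e e0.
by exists y; split=> //; apply: eB; split=> // i j; rewrite ord1 /ball/= distrC.
Qed.

Lemma compact_row_bounded K : compact K ->
  exists2 B : R, 0 < B & forall y j, K y -> `|y 0 j| <= B.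
Proof.
move=> /compact_bounded[B0 [_ HB]].
exists (Num.max 1 (B0 + 1)); first by rewrite lt_max ltr01.
move=> y j Ky; have : `|y| <= Num.max 1 (B0 + 1).
  by apply: HB => //; rewrite lt_max ltrDl ltr01 orbT.
apply: le_trans; rewrite [leRHS]mx_normrE.
exact: (@le_bigmax _ _ _ 0 (fun ij : 'I_1 * 'I_k => `|y ij.1 ij.2|) (0, j)).
Qed.

Lemma injective_unbounded (g : nat -> nat) m : injective g ->
  exists n, (m <= g n)%N.
Proof.
move=> g_inj; apply: contrapT => nex.
have gm n : (g n < m)%N.
  by rewrite ltnNge; apply/negP => mg; apply: nex; exists n.
pose f (i : 'I_m.+1) : 'I_m := Ordinal (gm i).
have f_inj : injective f by move=> i j [/g_inj/val_inj].
by have := leq_card f f_inj; rewrite !card_ord ltnn.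
Qed.

(** The index n encodes a rational vector, a precision m and a dummy counter; [Y n] is a point of
    [K] that close to the rational vector whenever one exists. The dummy counter makes each target
    recur at arbitrarily large indices. *)
Lemma recurrent_dense_sequence K : K !=set0 ->
  exists Y : nat -> 'rV[R]_k, (forall n, K (Y n)) /\
    forall x (e : R) m, K x -> 0 < e ->
      exists2 n, (m <= n)%N & forall j, `|Y n 0 j - x 0 j| < e.
Proof.
move=> [y0 Ky0].
pose near_ (q : 'rV[rat]_k) (m : nat) y :=
  K y /\ forall j, `|y 0 j - ratr (q 0 j)| < m.+1%:R^-1.
have exY n : exists y, K y /\ forall q m (i : nat),
    unpickle n = Some (q, m, i) -> (exists y', near_ q m y') -> near_ q m y.
  case: (unpickle n) => [[[q m] i]|]; last by exists y0.
  have [[y' Hy']|nex] := pselect (exists y', near_ q m y').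
    by exists y'; split=> [|q' m' i' [<- <- _] _//]; have [] := Hy'.
  by exists y0; split=> // q' m' i' [<- <- _].
have [Y HY] := choice exY.
exists Y; split=> [n|x e m Kx e0]; first by have [] := HY n.
have [|m0 Hm0] := @ltr_add_invr R 0 (e / 2); first by rewrite divr_gt0.
rewrite add0r in Hm0.
have exq j : exists q : rat, `|x 0 j - ratr q| < m0.+1%:R^-1.
  have : x 0 j - m0.+1%:R^-1 < x 0 j + m0.+1%:R^-1.
    have : 0 < m0.+1%:R^-1 :> R by [].
    by move: (m0.+1%:R^-1) => w w0; lra.
  move=> /rat_in_itvoo[q]; rewrite in_itv/= => /andP[q1 q2].
  exists q; rewrite ltr_norml; move: (m0.+1%:R^-1) q1 q2 => w q1 q2.
  by apply/andP; split; lra.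
have [q Hq] := choice exq.
pose qr : 'rV[rat]_k := \row_j q j.
have nearx : near_ qr m0 x by split=> // j; rewrite mxE.
have [|i mi] := @injective_unbounded (fun i => pickle (qr, m0, i)) m.
  by move=> i i' /(pcan_inj pickleK)[].
exists (pickle (qr, m0, i)) => // j.
have [_ /(_ qr m0 i)] := HY (pickle (qr, m0, i)).
rewrite pickleK => /(_ erefl (ex_intro _ x nearx))[_ /(_ j)].
have [_ /(_ j)] := nearx; move: (m0.+1%:R^-1) Hm0 => w we.
rewrite !ltr_norml => /andP[? ?] /andP[? ?]; apply/andP; split; lra.
Qed.

End CompactRowSets.

(** * Defining a compact set from its codes *)

Ltac definability := rewrite /=; repeat first
  [ match goal with H : forall _, _ |- _ => solve [apply: H] end
  | apply: definable_predN | apply: definable_predI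
  | apply: definable_pred_lt | apply: definable_pred_le
  | apply: definable_pred_eq
  | apply: definable_termD | apply: definable_termMn
  | solve [apply: definable_term_var] | solve [apply: definable_term_cst]
  | apply: definable_pred_ex => /= | apply: definable_pred_all => /=
  | apply: definable_pred_imp
  | apply: definable_pred_fin => ? ].

Section CompactDefinable.
Variables (R : realType) (L : language) (M : expansion R L).
Variables (D E : set R) (prec : R -> R -> Prop) (h : R -> R -> R).
Hypothesis D_def : forall i, definable_pred M (fun v => D (v i)).
Hypothesis E_def : forall i, definable_pred M (fun v => E (v i)).
Hypothesis prec_def :
  forall i j, definable_pred M (fun v => prec (v i) (v j)).
Hypothesis h_def : forall i j l, definable_pred M
  (fun v => [/\ E (v i), 0 <= v j <= v i & v l = h (v i) (v j)]).
Variables (d : nat -> R) (delta a b : R).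
Hypothesis d_inj : injective d.
Hypothesis D_range : D = range d.
Hypothesis precE : forall i j, prec (d i) (d j) <-> (i < j)%N.
Hypothesis ab : a < b.
Hypothesis d_dense :
  forall p q, a <= p -> p < q -> q <= b -> exists i, p < d i /\ d i < q.
Hypothesis E_closed : exists2 C : set R, closed C & E = C `&` [set r | 0 < r].
Hypothesis E_small : forall e : R, 0 < e -> `]0, e[ `&` E !=set0.
Hypothesis h_cont : forall r, E r -> {within `[0, r], continuous (h r)}.
Hypothesis delta0 : 0 < delta.
Hypothesis h_onto : forall r, E r -> `[0, delta] `<=` h r @` `[0, r].

(** Indices are not elements of the structure, so i is represented by the point [d i], and
    [initial d i] by this definable set. Negating [prec t e] keeps t itself in the set. *)
Let below (t : R) : set R := [set e | D e /\ ~ prec t e].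

Lemma below_initial i : below (d i) = initial d i.
Proof.
rewrite /below /initial D_range; apply/seteqP; split=> [_ [[e _ <-]]|_ [e /= ei <-]].
  by rewrite precE => /negP; rewrite -leqNgt; exists e.
by split; [exists e|rewrite precE; apply/negP; rewrite -leqNgt].
Qed.

Lemma decodes_def i c l :
  definable_pred M (fun v => decodes E h (below (v i)) c (v l)).
Proof. by rewrite /decodes /below; definability. Qed.

(** The vector v is a limit point of the decoded sequence: beyond every m in [D] some left record t
    of c has all decoded values, rescaled by [N] and translated by [B], within e of v. *)
Let limit_formula k c (cs : 'I_k -> R) (B : R) (N : nat) (v : nat -> R) : Prop :=
  forall e, 0 < e -> forall m, D m -> exists t, D t /\ prec m t /\
    (t < c /\ forall e, D e -> prec e t -> ~ (t < e /\ e < c)) /\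
    forall j, exists z, decodes E h (below t) (cs j) z /\
      z *+ N < v j + B + e /\ v j + B < z *+ N + e.

Lemma limit_formula_def k c (cs : 'I_k -> R) B N :
  definable_pred M (limit_formula c cs B N).
Proof.
by rewrite /limit_formula; have decodes_def := decodes_def; definability.
Qed.

Lemma compact_definable k (K : set 'rV[R]_k) : compact K -> definable M K.
Proof.
move=> cK; apply: definable_of_pred.
have [->|/set0P K0] := eqVneq K set0.
  apply: (@eq_definable_pred _ _ _ (fun=> (0 : R) < 0)) => [v|]; last by definability.
  by rewrite ltxx.
have [B B0 HB] := compact_row_bounded cK.
have [Y [KY Ydense]] := recurrent_dense_sequence K0.
(* Chosen so that the translate of [K] into [0, 2B]^k, divided by [N], fits in [0, delta]^k. A
   natural number is taken because z *+ N is a term. *)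
pose N := (Num.bound (2 * B / delta)).+1.
have N0 : 0 < N%:R :> R by [].
have NB : 2 * B <= delta * N%:R.
  rewrite -ler_pdivrMl// mulrC.
  have : 2 * B / delta < (Num.bound (2 * B / delta))%:R.
    by apply: archi_boundP; rewrite divr_ge0 ?mulr_ge0// ltW.
  by move=> /ltW/le_trans; apply; rewrite ler_nat.
pose y n (j : 'I_k) := (Y n 0 j + B) / N%:R.
have y_itv n j : 0 <= y n j <= delta.
  have := HB _ j (KY n); rewrite ler_norml => /andP[Y1 Y2].
  rewrite /y divr_ge0 ?(ltW N0)//=; last lra.
  by rewrite ler_pdivrMr//; lra.
(* The error is divided by [N] in advance, leaving 1/(n+1) after rescaling. *)
have eps0 n : 0 < n.+1%:R^-1 / N%:R :> R by rewrite divr_gt0// invr_gt0.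
have [c [cs [t [tS trec recE tval]]]] :=
  coding d_inj d_dense E_closed E_small h_cont h_onto ab y_itv eps0.
have tmono : {mono t : m n / (m < n)%N}.
  exact/leqW_mono/leq_mono/(homo_ltn ltn_trans).
have t_ge n : (n <= t n)%N.
  by elim: n => [//|n IH]; exact: leq_ltn_trans IH (tS n).
have approx n j z : decodes E h (initial d (t n)) (cs j) z ->
    `|z *+ N - (Y n 0 j + B)| < n.+1%:R^-1.
  move=> /(tval n j).2; rewrite ltr_pdivlMr// -[X in _ * X]gtr0_norm// -normrM.
  by rewrite mulrBl /y divfK ?gt_eqF// mulr_natr.
have inv_small (e : R) : 0 < e ->
    exists n0, forall n, (n0 <= n)%N -> n.+1%:R^-1 < e.
  move=> e0; have [n0] := @ltr_add_invr R 0 e e0; rewrite add0r => n0e.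
  exists n0 => n n0n; apply: le_lt_trans n0e.
  by rewrite lef_pV2 ?posrE// ler_nat ltnS.
apply: eq_definable_pred (limit_formula_def c cs B N) => v; split; last first.
  (* For v in [K], choose n so large that [t n] passes m and the coding error is below e/2, with
     [Y n] within e/2 of v. *)
  move=> Kv e e0 m; rewrite D_range => -[im _ <-].
  have e20 : 0 < e / 2 by rewrite divr_gt0.
  have [n0 Hn0] := inv_small _ e20.
  have [n] := Ydense _ _ (maxn n0 im.+1) Kv e20.
  rewrite geq_max => /andP[n0n imn] Yv.
  exists (d (t n)); split; first by exists (t n).
  split; first by rewrite precE; exact: leq_trans imn (t_ge n).
  have [tc trn] := trec n.
  split; first split=> // _ [e' _ <-].
    by rewrite precE; exact: trn.
  move=> j; have [[z Hz] _] := tval n j; exists z; rewrite below_initial.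
  split=> //; have := approx _ _ _ Hz; have := Yv j; have := Hn0 n n0n.
  move: (n.+1%:R^-1) => w; rewrite mxE !ltr_norml => ? /andP[? ?] /andP[? ?]; split; lra.
(* Conversely, a left record beyond [d (t n0)] must be some [t n] with n > n0, so [Y n] is a point
   of [K] within e of v. *)
move=> Hv; apply: (compact_row_closed cK) => e e0.
have e20 : 0 < e / 2 by rewrite divr_gt0.
have [n0 Hn0] := inv_small _ e20.
have Dt : D (d (t n0)) by rewrite D_range; exists (t n0).
have [t' []] := Hv (e / 2) e20 (d (t n0)) Dt.
rewrite [X in X t' -> _]D_range => -[i _ <-] []; rewrite precE => ti [[ic Hi] Hz].
have [||n ni] := recE i.
- by apply: leq_trans (ltnW ti); rewrite leqNgt tmono.
- split=> // e' e'i; apply: Hi; first by rewrite D_range; exists e'.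
  by rewrite precE.
rewrite ni tmono in ti.
exists (Y n) => // j; have [z []] := Hz j.
rewrite below_initial ni => /approx; rewrite mxE.
have := Hn0 n (ltnW ti); move: (n.+1%:R^-1) => w.
rewrite !ltr_norml => ? /andP[? ?] [? ?]; apply/andP; split; lra.
Qed.

End CompactDefinable.

(** * From type B and a weak pole to the data of the coding *)

Theorem theorem5p2 (R : realType) (L : language) (M : expansion R L) :
  type_B M -> ~ defines_weak_pole M.
Proof.
move=> [[D [D_def D_order] [I [_ oI [x0 Ix0] ID]]] [k [K [cK nK]]]].
move=> [E [h [[E_def h_def] h_cont E_closed E_small [delta delta0 h_onto]]]].
apply: nK.
have [eta /= eta0 etaI] : exists2 eta : R, 0 < eta & ball x0 eta `<=` I.
  by apply/nbhs_ballP; apply: open_nbhs_nbhs; split.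
pose a := x0 - eta / 2; pose b := x0 + eta / 2.
have D_dense (p q : R) : a <= p -> p < q -> q <= b -> exists x, D x /\ p < x /\ x < q.
  move=> ap pq qb.
  have [||x [[Dx _] /=]] := ID ((p + q) / 2) _ `]p, q[%classic.
  - by apply: etaI; rewrite /ball/= ltr_norml; move: ap qb; rewrite /a /b => ap qb; apply/andP; split; lra.
  - by apply: near_in_itvoo; rewrite in_itv/=; apply/andP; split; lra.
  - by rewrite in_itv/= => /andP[px xq]; exists x.
have ab : a < b by rewrite /a /b; lra.
(* A finite [D] is impossible: some subinterval of ]a, b[ avoids it, against density. *)
case: D_order => [finD|[prec0 prec_def0 [f [ff f_inj f_surj] fE]]].
  have /finite_seqP[s Ds] : finite_set D.
    have -> : D = (fun x : 'rV[R]_1 => x 0 0) @` set_row1 D.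
      apply/seteqP; split=> [x Dx|_ [x /= Dx <-]//].
      by exists (\row_(_ < 1) x); rewrite /set_row1/= mxE.
    exact: finite_image.
  have [q [aq qb Hq]] := shrink_avoiding s ab.
  have [x [Dx xq]] := D_dense _ _ (lexx a) aq (ltW qb).
  by case: (Hq x) => //; rewrite Ds in Dx.
(* Only the restriction of the ordering to [D] is known to be definable, so membership in [D] is
   built in. *)
pose prec x y := [/\ D x, D y & prec0 (\row_(_ < 1) x) (\row_(_ < 1) y)].
pose d i := f i 0 0.
have rowd i : \row_(_ < 1) d i = f i by apply/rowP => j; rewrite mxE ord1.
have Dd i : D (d i) by exact: (ff i).
apply: (@compact_definable _ _ _ D E prec h _ _ _ _ d delta a b) => //.
- move=> i; apply: eq_definable_pred (definable_pred_mem (fun=> i) D_def) => v.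
  by rewrite /set_row1/= mxE.
- move=> i; apply: eq_definable_pred (definable_pred_mem (fun=> i) E_def) => v.
  by rewrite /set_row1/= mxE.
- move=> i j; pose g (l : 'I_(1 + 1)) := if l == 0 then i else j.
  apply: eq_definable_pred (definable_pred_mem g prec_def0) => v /=.
  have -> : lsubmx (\row_l v (g l)) = \row_(_ < 1) v i.
    by apply/rowP => l; rewrite !mxE ord1.
  have -> : rsubmx (\row_l v (g l)) = \row_(_ < 1) v j.
    by apply/rowP => l; rewrite !mxE ord1.
  by rewrite /set_row1 /prec/= !mxE.
- move=> i j l; pose g (m : 'I_3) := [:: i; j; l]`_m.
  apply: eq_definable_pred (definable_pred_mem g h_def) => v /=.
  by rewrite !mxE.
- move=> i j dij; apply: f_inj; rewrite ?inE//.
  by rewrite -!rowd dij.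
- apply/seteqP; split=> [x Dx|_ [i _ <-]//].
  have [|i _ fi] := f_surj (\row_(_ < 1) x); first by rewrite /set_row1/= mxE.
  by exists i => //; rewrite /d fi mxE.
- move=> i j; rewrite /prec !rowd fE; split=> [[]//|].
  by split.
- move=> p q ap pq qb; have [x [Dx pxq]] := D_dense p q ap pq qb.
  have [|i _ fi] := f_surj (\row_(_ < 1) x); first by rewrite /set_row1/= mxE.
  by exists i; rewrite /d fi mxE.
Qed.
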